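(* Let $\Xi=\{\xi\in\mathbb{R}^{m(n+1)}:\ C\xi\le d\}$ be a polytope with non-empty interior, where $C=[C_1,\dots,C_m]$, $C_j\in\mathbb{R}^{n_d\times(n+1)}$, $d\in\mathbb{R}^{n_d}$. Let $P=[P_1,\dots,P_m]$, $P_j\in\mathbb{R}^{n_0\times(n+1)}$, be a matrix of full row rank and let $\Omega$ be a pole-set of $P\Xi$. Fix $u\in\mathbb{R}^n$, $(v_\omega)_{\omega\in\Omega}\subset\mathbb{R}^q$ and $i\in\{1,\dots,m\}$. Then the $i$-th constraint of the multipolar robust counterpart, $$U_iu+V_i\sum_{\omega\in\Omega}\lambda_\omega v_\omega\le b_i\qquad\text{for all }\xi\equiv[U,b]\in\Xi,\ \lambda\in\Lambda_\xi,$$ holds if and only if there exist $\eta_i\in\mathbb{R}^{n_d}_+$ and $\sigma_i\in\mathbb{R}^{n_0}$ such that $$d^T\eta_i+V_iv_\omega-\omega^T\sigma_i\le 0\quad\text{for all }\omega\in\Omega,$$ $$C_j^T\eta_i-P_j^T\sigma_i=\delta_{ij}\,(u,-1)\quad\text{for all }j=1,\dots,m.$$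
   Context: An uncertain parameter $\xi\equiv[U,b]$, with $U\in\mathbb{R}^{m\times n}$, $b\in\mathbb{R}^m$, is written as a column vector of size $m(n+1)$ made of $m$ blocks of size $n+1$: the $i$-th block is $U_i^T$ (transpose of the $i$-th row of $U$) followed by $b_i$. The matrices $C$ and $P$ are partitioned by columns accordingly. $V\in\mathbb{R}^{m\times q}$ is fixed with $i$-th row $V_i$. $(u,-1)\in\mathbb{R}^{n+1}$ is the column vector $u$ followed by $-1$; $\delta_{ij}$ is the Kronecker delta. A pole-set of $P\Xi=\{P\xi:\xi\in\Xi\}$ is a finite set $\Omega\subset\mathbb{R}^{n_0}$ with $P\Xi\subseteq\operatorname{conv}\Omega$, and for $\xi\in\Xi$, $\Lambda_\xi=\{\lambda\in\mathbb{R}^\Omega_{\ge0}:\sum_\omega\lambda_\omega\omega=P\xi,\ \sum_\omega\lambda_\omega=1\}$. *)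

(* Defs.v *)
From HB Require Import structures.
From mathcomp Require Export all_boot all_order all_algebra finmap.
From mathcomp Require Export all_classical all_reals all_analysis.

Set Implicit Arguments.
Unset Strict Implicit.
Unset Printing Implicit Defensive.

Import Order.TTheory GRing.Theory Num.Theory.
Import numFieldNormedType.Exports.

Local Open Scope classical_set_scope.
Local Open Scope ring_scope.

(* [mxvec] lists a matrix row by row, so this is the column vector made of m
   blocks of size n + 1, the i-th one being (U_i)^T followed by b_i. *)
Definition uncertain (R : realType) (m n : nat) (U : 'M[R]_(m, n))
    (b : 'cV[R]_m) : 'cV[R]_(m * (n + 1)) :=
  (mxvec (row_mx U b))^T.

(* A_j in the partition A = [A_1, ..., A_m] matching the blocks of
   [uncertain U b], see [mul_uncertain]. *)
Definition colblock (R : realType) (p m n : nat) (A : 'M[R]_(p, m * (n + 1)))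
    (j : 'I_m) : 'M[R]_(p, n + 1) :=
  colsub (mxvec_index j) A.

Lemma mul_uncertain (R : realType) (p m n : nat) (A : 'M[R]_(p, m * (n + 1)))
    (U : 'M[R]_(m, n)) (b : 'cV[R]_m) :
  A *m uncertain U b =
  \sum_(j < m) colblock A j *m col_mx (row j U)^T (b j 0)%:M.
Proof.
have rowE j : col_mx (row j U)^T (b j 0)%:M = (row j (row_mx U b))^T.
  rewrite row_row_mx tr_row_mx; congr col_mx.
  by apply/matrixP => k l; rewrite !ord1 !mxE eqxx.
apply/matrixP => k l; rewrite summxE mxE (reindex _ (curry_mxvec_bij _ _)) /=.
rewrite (eq_bigr (fun p => A k (mxvec_index p.1 p.2) *
  uncertain U b (mxvec_index p.1 p.2) l)); last by case.
rewrite -(pair_bigA _ (fun j c => A k (mxvec_index j c) *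
  uncertain U b (mxvec_index j c) l)) /=.
apply: eq_bigr => j _; rewrite rowE mxE; apply: eq_bigr => c _.
by rewrite !ord1 !mxE mxvecE mxE.
Qed.

Definition polyhedron (R : realType) (p N : nat) (C : 'M[R]_(p, N))
    (d : 'cV[R]_p) : set 'cV[R]_N :=
  [set xi | forall k, (C *m xi) k 0 <= d k 0].

Definition convex_hull (R : realType) (N : nat) (A : set 'cV[R]_N) :
    set 'cV[R]_N :=
  \bigcap_(B in [set B : set (convex_lmodType 'cV[R]_N) |
                convex_set B /\ A `<=` B]) B.

Definition pole_set (R : realType) (N : nat) (Omega : {fset 'cV[R]_N})
    (A : set 'cV[R]_N) : Prop :=
  A `<=` convex_hull [set` Omega].

Definition Lambda (R : realType) (N : nat) (Omega : {fset 'cV[R]_N})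
    (x : 'cV[R]_N) : set (Omega -> R) :=
  [set lam | [/\ forall w, 0 <= lam w,
     \sum_(w : Omega) lam w *: val w = x & \sum_(w : Omega) lam w = 1]].

Arguments Lambda {R N} Omega x.

(* Main.v *)
(* Homogenising with t = \sum_w lambda_w, the robust constraint says that
   a xi + \sum_w lambda_w (V_i v_w) <= 0 on the cone
     C xi <= t d,   P xi = \sum_w lambda_w w,   lambda >= 0,
   where a is the functional [U, b] |-> U_i u - b_i: for t > 0 rescale by 1/t,
   and for t = 0 both lambda and xi vanish, xi being a recession direction of
   the bounded polyhedron. The homogeneous Farkas lemma on this cone yields the
   multipliers eta (of C xi <= t d) and sigma (of P xi = \sum_w lambda_w w). *)
Require Import Defs.
From mathcomp Require Import all_boot all_order all_algebra finmap.
From mathcomp Require Import all_classical all_reals all_analysis.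
From mathcomp Require Import lra.
Import Order.TTheory GRing.Theory Num.Theory.
Import numFieldNormedType.Exports.
Local Open Scope classical_set_scope.
Local Open Scope ring_scope.

(* Bartl's induction on the number of inequalities: if the inequality [a] is
   not redundant, it is eliminated by projecting along some [x1] that violates
   the conclusion, normalised by [a *m x1 = 1]. *)
Lemma farkas {R : realFieldType} {p N : nat} (A : 'M[R]_(p, N))
    (c : 'rV[R]_N) :
  (forall x : 'cV[R]_N, (forall k, (A *m x) k 0 <= 0) -> (c *m x) 0 0 <= 0) ->
  exists2 y : 'rV[R]_p, (forall k, 0 <= y 0 k) & y *m A = c.
Proof.
elim: p A c => [|p IH] A c Ac.
  have cx (x : 'cV[R]_N) : (c *m x) 0 0 <= 0 by apply: Ac => - [].
  exists 0; first by case.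
  apply/matrixP => k j; rewrite mul0mx mxE ord1.
  have := cx (delta_mx j 0); have := cx (- delta_mx j 0).
  by rewrite mulmxN -colE !mxE oppr_le0 => c0 c0'; apply/eqP; rewrite eq_le c0.
pose a : 'rV[R]_N := usubmx (A : 'M[R]_(1 + p, N)).
pose B : 'M[R]_(p, N) := dsubmx (A : 'M[R]_(1 + p, N)).
have defA : A = col_mx a B by rewrite vsubmxK.
have [redundant|/existsNP[x0 /not_implyP[Bx0 /negP]]] :=
    pselect (forall x : 'cV[R]_N, (forall k, (B *m x) k 0 <= 0) ->
             (c *m x) 0 0 <= 0).
  have [y y0 yB] := IH B c redundant.
  exists (row_mx (0 : 'M[R]_1) y); last first.
    by rewrite defA (mul_row_col (0 : 'M[R]_1) y a B) mul0mx add0r.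
  by move=> k; rewrite mxE; case: splitP => j _ //; rewrite mxE.
rewrite -ltNge => cx0.
have Ax (x : 'cV[R]_N) : (a *m x) 0 0 <= 0 -> (forall k, (B *m x) k 0 <= 0) ->
    (c *m x) 0 0 <= 0.
  move=> ax Bx; apply: Ac => k; rewrite defA (mul_col_mx a B x) mxE.
  by case: splitP => j _ //; rewrite (ord1 j).
have ax0 : 0 < (a *m x0) 0 0.
  by rewrite ltNge; apply/negP => /Ax/(_ Bx0); rewrite leNgt cx0.
pose x1 := ((a *m x0) 0 0)^-1 *: x0.
have ax1 : a *m x1 = 1%:M.
  by rewrite [LHS]mx11_scalar /x1 -scalemxAr mxE mulVf ?lt0r_neq0.
have cx1 : 0 <= (c *m x1) 0 0.
  by rewrite /x1 -scalemxAr mxE mulr_ge0 ?invr_ge0 ?ltW.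
have Bx1 k : (B *m x1) k 0 <= 0.
  by rewrite /x1 -scalemxAr mxE mulr_ge0_le0 // invr_ge0 ltW.
(* These are [B] and [c] composed with the projection [x - x1 *m (a *m x)]. It lands in the kernel
   of [a] because [a *m x1 = 1], so [Ax] applies to the projected point. *)
have [|y y0 yB] := IH (B - B *m x1 *m a) (c - c *m x1 *m a).
  move=> x Bx.
  have proj r (D : 'M[R]_(r, N)) :
      (D - D *m x1 *m a) *m x = D *m (x - x1 *m (a *m x)).
    by rewrite mulmxBl mulmxBr !mulmxA.
  rewrite proj; apply: Ax => [|k]; last by rewrite -proj.
  by rewrite mulmxBr mulmxA ax1 mul1mx subrr mxE.
(* Expanding [yB] leaves this coefficient in front of [a]; it is nonnegative since [c] is
   nonnegative and [B] nonpositive at [x1]. *)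
exists (row_mx (c *m x1 - y *m B *m x1) y).
  move=> k; rewrite mxE; case: splitP => j _ //.
  rewrite (ord1 j) mxE addr_ge0 // mxE -mulmxA mxE oppr_ge0.
  by apply: sumr_le0 => l _; rewrite mulr_ge0_le0.
rewrite defA (mul_row_col (_ : 'M[R]_1) y a B) mulmxBl.
move: yB; rewrite mulmxBr !mulmxA => yB.
by rewrite -addrA [- _ + _]addrC yB addrC subrK.
Qed.

(** From any point of the polyhedron the whole ray in direction [x] stays inside, which boundedness
    forbids unless [x] vanishes. *)
Lemma bounded_polyhedron_recession {R : realType} {p N : nat}
    (C : 'M[R]_(p, N)) (d : 'cV[R]_p) (x : 'cV[R]_N) :
  bounded_set (polyhedron C d) -> polyhedron C d !=set0 ->
  (forall k, (C *m x) k 0 <= 0) -> x = 0.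
Proof.
move=> [M [_ bdM]] [x0 Cx0] Cx; apply/eqP; rewrite -normr_eq0.
apply: contraT => x_neq0.
have x_gt0 : 0 < `|x| by rewrite lt_neqAle eq_sym x_neq0 normr_ge0.
(* [bdM] gives a bound only for numbers strictly above [M], hence the added 1. The length [s] makes
   the norm of [s *: x] exceed by 1 what the triangle inequality permits. *)
pose M1 := `|M| + 1; have M1_gt0 : 0 < M1 by rewrite ltr_wpDl.
pose s := (M1 + `|x0| + 1) / `|x|.
have s_ge0 : 0 <= s by rewrite divr_ge0 ?addr_ge0 // ltW.
have : `|x0 + s *: x| <= M1.
  apply: bdM; first by rewrite (le_lt_trans (ler_norm _)) // ltrDl.
  move=> k; rewrite mulmxDr -scalemxAr mxE [X in _ + X]mxE.
  by rewrite -[leRHS]addr0 lerD // mulr_ge0_le0.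
have : `|s *: x| <= `|x0 + s *: x| + `|x0|.
  by rewrite -[X in `|X| <= _](addKr x0) addrC (le_trans (ler_normB _ _)).
rewrite normrZ (ger0_norm s_ge0) divfK // => h1 h2.
have := le_trans h1 (lerD h2 (lexx _)).
by rewrite gerDl ler10.
Qed.

Lemma colblock_mul {R : realType} {r p m n : nat} (D : 'M[R]_(r, p))
    (A : 'M[R]_(p, m * (n + 1))) (j : 'I_m) :
  colblock (D *m A) j = D *m colblock A j.
Proof. by rewrite /colblock mulmx_colsub. Qed.

Lemma colblock_inj {R : realType} {p m n : nat} (A B : 'M[R]_(p, m * (n + 1))) :
  colblock A =1 colblock B -> A = B.
Proof.
move=> AB; apply/matrixP => k l; case/mxvec_indexP: l => j l.
by have /matrixP/(_ k l) := AB j; rewrite !mxE.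
Qed.

Lemma uncertain_surj {R : realType} {m n : nat} (x : 'cV[R]_(m * (n + 1))) :
  exists U b, x = uncertain U b.
Proof.
exists (lsubmx (vec_mx x^T)), (rsubmx (vec_mx x^T)).
by rewrite /uncertain hsubmxK vec_mxK trmxK.
Qed.

(** The functional $[U,b] \mapsto U_i u - b_i$ as a row vector, built with [mxvec] so that its
    blocks are the transposed right-hand sides $\delta_{ij}(u,-1)$ of the dual equations. *)
Definition constraint_row {R : realType} {m n : nat} (i : 'I_m)
    (u : 'cV[R]_n) : 'rV[R]_(m * (n + 1)) :=
  mxvec (delta_mx i 0 *m (col_mx u (const_mx (-1)))^T).

Lemma colblock_constraint_row {R : realType} {m n : nat} (i j : 'I_m)
    (u : 'cV[R]_n) :
  colblock (constraint_row i u) j =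
    ((i == j)%:R *: col_mx u (const_mx (-1)))^T.
Proof.
apply/matrixP => k l; rewrite ord1 !mxE mxvecE mxE big_ord1 !mxE eqxx andbT.
by rewrite eq_sym.
Qed.

Lemma constraint_row_uncertain {R : realType} {m n : nat} (i : 'I_m)
    (u : 'cV[R]_n) (U : 'M[R]_(m, n)) (b : 'cV[R]_m) :
  (constraint_row i u *m uncertain U b) 0 0 = (row i U *m u) 0 0 - b i 0.
Proof.
rewrite mul_uncertain (bigD1 i) //= big1 ?addr0 => [|j /negPf ji]; last first.
  by rewrite colblock_constraint_row eq_sym ji scale0r trmx0 mul0mx.
rewrite colblock_constraint_row eqxx scale1r tr_col_mx mul_row_col mxE.
rewrite -trmx_mul mxE; congr (_ + _).
by rewrite !mxE big_ord1 !mxE eqxx mulN1r.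
Qed.

(** Numbering the index type by [enum_val] lets weights on the poles be a column vector, as [farkas]
    requires. *)
Definition points_mx {R : realType} {N : nat} {I : finType}
    (f : I -> 'cV[R]_N) : 'M[R]_(N, #|I|) := \matrix_(k, j) f (enum_val j) k 0.

Lemma mul_points_mx {R : realType} {N : nat} {I : finType} (f : I -> 'cV[R]_N)
    (l : 'cV[R]_#|I|) :
  points_mx f *m l = \sum_w l (enum_rank w) 0 *: f w.
Proof.
apply/matrixP => k j; rewrite ord1 mxE summxE.
rewrite (reindex_onto (@enum_rank I) enum_val) => [|i _]; last exact: enum_valK.
rewrite (eq_bigl xpredT) => [|w]; last by rewrite enum_rankK eqxx.
by apply: eq_bigr => w _; rewrite !mxE enum_rankK mulrC.
Qed.

Theorem mainTheorem9 (R : realType) (m n q nd n0 : nat)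
    (C : 'M[R]_(nd, m * (n + 1))) (d : 'cV[R]_nd)
    (Xi_bounded : bounded_set (polyhedron C d))
    (Xi_interior : (polyhedron C d)° !=set0)
    (P : 'M[R]_(n0, m * (n + 1))) (P_full : row_free P)
    (Omega : {fset 'cV[R]_n0})
    (Omega_pole : pole_set Omega (mulmx P @` polyhedron C d))
    (V : 'M[R]_(m, q)) (u : 'cV[R]_n) (v : Omega -> 'cV[R]_q) (i : 'I_m) :
  (forall (U : 'M[R]_(m, n)) (b : 'cV[R]_m) (lam : Omega -> R),
     polyhedron C d (uncertain U b) ->
     Lambda Omega (P *m uncertain U b) lam ->
     (row i U *m u) 0 0 + (row i V *m \sum_(w : Omega) lam w *: v w) 0 0
       <= b i 0)
  <->
  (exists (eta : 'cV[R]_nd) (sigma : 'cV[R]_n0),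
    [/\ forall k, 0 <= eta k 0,
        forall w : Omega,
          (d^T *m eta) 0 0 + (row i V *m v w) 0 0 - ((val w)^T *m sigma) 0 0
            <= 0
      & forall j : 'I_m,
          (colblock C j)^T *m eta - (colblock P j)^T *m sigma
            = (i == j)%:R *: col_mx u (const_mx (-1))]).
Proof.
pose a : 'rV[R]_(m * (n + 1)) := constraint_row i u.
pose Vv (w : Omega) : 'cV[R]_1 := row i V *m v w.
pose W := points_mx (val : Omega -> 'cV[R]_n0).
pose c : 'rV[R]__ := points_mx Vv.
pose ones : 'rV[R]_#|{: Omega}| := const_mx 1.
have sum_ones (l : 'cV[R]_#|{: Omega}|) :
    (ones *m l) 0 0 = \sum_w l (enum_rank w) 0.
  have -> : ones = points_mx (fun _ : Omega => const_mx 1).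
    by apply/matrixP => k j; rewrite !mxE.
  rewrite mul_points_mx summxE; apply: eq_bigr => w _.
  by rewrite !mxE mulr1.
have mul_c (l : 'cV[R]_#|{: Omega}|) :
    c *m l = row i V *m \sum_w l (enum_rank w) 0 *: v w.
  rewrite mul_points_mx mulmx_sumr; apply: eq_bigr => w _.
  by rewrite -scalemxAr.
split=> [robust|
  [eta [sigma [eta0 etaOmega etaC]]] U b lam CUb [lam0 lamP lam1]].
  (* The cone in the stacked unknown (x, l): the equation [P *m x = W *m l] enters as two opposite
     inequalities, and the last block says that [l] is nonnegative. *)
  pose A : 'M[R]_(nd + (n0 + (n0 + #|{: Omega}|)),
                  m * (n + 1) + #|{: Omega}|) :=
    col_mx (row_mx C (- d *m ones))
      (col_mx (row_mx P (- W)) (col_mx (row_mx (- P) W) (row_mx 0 (- 1%:M)))).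
  have [z Az|y y0 yA] := farkas A (row_mx a c).
    have Az1 k := Az (lshift _ k).
    have Az2 k := Az (rshift nd (lshift _ k)).
    have Az3 k := Az (rshift nd (rshift n0 (lshift _ k))).
    have Az4 k := Az (rshift nd (rshift n0 (rshift n0 k))).
    move: Az1 Az2 Az3 Az4 {Az}.
    rewrite -[z]vsubmxK !mul_col_mx !mul_row_col.
    set x := usubmx z; set l := dsubmx z => Az1 Az2 Az3 Az4.
    have l_ge0 k : 0 <= l k 0.
      have := Az4 k; rewrite !col_mxEd mul0mx add0r mulNmx mul1mx mxE.
      by rewrite oppr_le0.
    have Px : P *m x = W *m l.
      apply/matrixP => k j; rewrite ord1; apply/eqP; rewrite eq_le.
      have := Az2 k; have := Az3 k.
      rewrite !col_mxEd !col_mxEu !mulNmx !mxE.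
      by rewrite addrC !subr_le0 => -> ->.
    pose t := (ones *m l) 0 0.
    have Cx k : (C *m x) k 0 <= t * d k 0.
      have := Az1 k; rewrite col_mxEu -mulmxA [ones *m l]mx11_scalar -/t.
      by rewrite mul_mx_scalar !mxE mulrN subr_le0.
    have t_ge0 : 0 <= t by rewrite /t sum_ones sumr_ge0.
    rewrite mxE; have [t_eq0|t_neq0] := eqVneq t 0.
      have l0 : l = 0.
        apply/matrixP => k j; rewrite ord1 [RHS]mxE.
        move: t_eq0; rewrite /t sum_ones => /psumr_eq0P/(_ (enum_val k) isT).
        by rewrite enum_valK => ->.
      have -> : x = 0.
        apply: bounded_polyhedron_recession Xi_bounded _ _ => [|k].
          by have [x0 /interior_subset ?] := Xi_interior; exists x0.
        by have := Cx k; rewrite t_eq0 mul0r.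
      by rewrite l0 !mulmx0 !mxE addr0.
    have t_gt0 : 0 < t by rewrite lt_neqAle eq_sym t_neq0.
    (* After division by [t], [x] becomes a parameter in the polyhedron and [l] a weight in its
       [Lambda]; the robust inequality there is the goal up to the positive factor [t^-1]. *)
    have [U [b Ub]] := uncertain_surj (t^-1 *: x).
    have := robust U b (fun w => t^-1 * l (enum_rank w) 0).
    rewrite -subr_le0 addrAC -constraint_row_uncertain -Ub -/a.
    have -> : \sum_w (t^-1 * l (enum_rank w) 0) *: v w =
        t^-1 *: \sum_w l (enum_rank w) 0 *: v w.
      by rewrite scaler_sumr; apply: eq_bigr => w _; rewrite scalerA.
    have scaleE s (D : 'M[R]_1) : (s *: D) 0 0 = s * D 0 0 by rewrite mxE.
    rewrite -!scalemxAr -mul_c !scaleE -mulrDr.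
    rewrite pmulr_rle0 ?invr_gt0 //; apply.
      by move=> k; rewrite -scalemxAr mxE ler_pdivrMl.
    split=> [w||].
    - by rewrite mulr_ge0 ?invr_ge0.
    - under eq_bigr do rewrite -scalerA.
      by rewrite -scaler_sumr -mul_points_mx Px.
    - by rewrite -mulr_sumr -sum_ones mulVf.
  (* One multiplier per block of [A]: [y1] is eta, the difference [y3 - y2] from the opposite
     inequalities is the sign-free sigma, and [y4] is the slack in the pole inequalities. *)
  pose y1 := lsubmx y; pose y2 := lsubmx (rsubmx y).
  pose y3 := lsubmx (rsubmx (rsubmx y)); pose y4 := rsubmx (rsubmx (rsubmx y)).
  have yE : y = row_mx y1 (row_mx y2 (row_mx y3 y4)) by rewrite !hsubmxK.
  move: yA; rewrite yE /A !mul_row_col !mul_mx_row !add_row_mx mulmx0 addr0.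
  move=> /eq_row_mx[aE cE].
  have a_eq : a = y1 *m C - (y3 - y2) *m P.
    by rewrite -aE mulmxN mulmxBl opprB.
  have c_eq : c = (y3 - y2) *m W - y1 *m d *m ones - y4.
    rewrite -cE mulNmx !mulmxN mulmx1 mulmxA mulmxBl.
    by rewrite [LHS]addrC addrA [- _ + _]addrC addrAC.
  exists y1^T, (y3 - y2)^T; split=> [k | w | j].
  - by have := y0 (lshift _ k); rewrite yE row_mxEl !mxE.
  - have y4_ge0 : 0 <= y4 0 (enum_rank w).
      have := y0 (rshift nd (rshift n0 (rshift n0 (enum_rank w)))).
      by rewrite yE !row_mxEr.
    have cw : c 0 (enum_rank w) = (row i V *m v w) 0 0.
      by rewrite mxE enum_rankK.
    have Ww (z : 'rV[R]_n0) : (z *m W) 0 (enum_rank w) = (z *m val w) 0 0.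
      by rewrite !mxE; apply: eq_bigr => k _; rewrite mxE enum_rankK.
    have subE (D E : 'rV[R]_#|{: Omega}|) k : (D - E) 0 k = D 0 k - E 0 k.
      by rewrite !mxE.
    have onesw (D : 'M[R]_1) : (D *m ones) 0 (enum_rank w) = D 0 0.
      by rewrite mxE big_ord1 mxE mulr1.
    move/matrixP/(_ 0 (enum_rank w)): c_eq.
    rewrite cw !subE Ww onesw => ->.
    rewrite -!trmx_mul ![_^T _ _]mxE.
    lra.
  - apply: trmx_inj; rewrite -colblock_constraint_row -/a a_eq.
    by rewrite linearB /= !trmx_mul !trmxK -!colblock_mul [RHS]linearB.
(* Converse: the block equations assemble into one identity, which evaluates the constraint at a
   parameter through [C] and [P]. *)
have aE : a = eta^T *m C - sigma^T *m P.
  apply: colblock_inj => j.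
  rewrite colblock_constraint_row -etaC linearB /= !trmx_mul !trmxK.
  by rewrite -!colblock_mul [RHS]linearB.
rewrite -subr_le0 addrAC -constraint_row_uncertain -/a aE.
rewrite mulmxBl -!mulmxA -lamP.
have sum00 (F : Omega -> 'cV[R]_1) :
    (\sum_w lam w *: F w) 0 0 = \sum_w lam w * F w 0 0.
  by rewrite summxE; apply: eq_bigr => w _; rewrite mxE.
have etaCd : (eta^T *m (C *m uncertain U b)) 0 0 <= (d^T *m eta) 0 0.
  rewrite [leLHS]mxE [leRHS]mxE ler_sum // => k _.
  by rewrite ![_^T _ _]mxE [leRHS]mulrC ler_wpM2l ?eta0 ?CUb.
(* The pole inequalities are averaged with the weights [lam]; as these sum to 1 and represent
   [P *m uncertain U b], only [etaCd] remains to compare. *)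
apply: le_trans (_ : \sum_w lam w * ((d^T *m eta) 0 0 + (row i V *m v w) 0 0 -
    ((val w)^T *m sigma) 0 0) <= _); last first.
  by apply: sumr_le0 => w _; rewrite mulr_ge0_le0.
under [leRHS]eq_bigr do rewrite mulrBr mulrDr.
rewrite sumrB big_split /= -mulr_suml lam1 mul1r.
have sumV : (row i V *m \sum_w lam w *: v w) 0 0 =
    \sum_w lam w * (row i V *m v w) 0 0.
  rewrite mulmx_sumr -sum00; congr (_ _ 0 0).
  by apply: eq_bigr => w _; rewrite -scalemxAr.
have sumP : (sigma^T *m \sum_w lam w *: val w) 0 0 =
    \sum_w lam w * ((val w)^T *m sigma) 0 0.
  rewrite mulmx_sumr summxE; apply: eq_bigr => w _.
  by rewrite -scalemxAr mxE -[sigma in RHS]trmxK -trmx_mul [_^T _ _]mxE.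
have subE (D E : 'M[R]_1) : (D - E) 0 0 = D 0 0 - E 0 0 by rewrite !mxE.
by rewrite subE sumV sumP addrAC lerD2r lerD2r.
Qed.
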